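(* Let $U\subset\mathbb{C}^{\times}$ be a set with $0\in\overline{U}$, and fix $\mathfrak{d}\in\mathbb{C}$. For each $\mathfrak{c}\in U$ let $X(s)=\mathfrak{c}s+\mathfrak{d}$. Let $\{\mathbf{u}_{\mathfrak{c}}:\mathfrak{c}\in U\}\subset\mathcal{P}'$ be a family of nonzero linear functionals such that, for every $\mathfrak{c}\in U$, $$\boldsymbol{\mathrm{D}}_{X}(\phi\,\mathbf{u}_{\mathfrak{c}})=\boldsymbol{\mathrm{S}}_{X}(\psi\,\mathbf{u}_{\mathfrak{c}}),$$ where $\phi(x)=ax^2+bx+c$ and $\psi(x)=dx+e$ are fixed polynomials (independent of $\mathfrak{c}$) with complex coefficients such that $an+d\neq 0$ for all $n\in\mathbb{N}$, and assume that $\langle\mathbf{u}_{\mathfrak{c}},1\rangle=1$ for all $\mathfrak{c}\in U$. Let $\mathbf{u}_0\in\mathcal{P}'$ denote the limit of $\mathbf{u}_{\mathfrak{c}}$ in the weak topology $\sigma(\mathcal{P}',\mathcal{P})$ as $\mathfrak{c}\to 0$ within $U$ (under these hypotheses this limit exists and is unique). Then $\mathbf{u}_0$ satisfies the functional equation $$\boldsymbol{\mathrm{D}}(\phi\,\mathbf{u}_0)=\psi\,\mathbf{u}_0,$$ where $\boldsymbol{\mathrm{D}}:\mathcal{P}'\to\mathcal{P}'$ is defined by $\langle\boldsymbol{\mathrm{D}}\mathbf{u},p\rangle=-\langle\mathbf{u},p'\rangle$ for all $p\in\mathcal{P}$, with $p'$ the usual derivative of $p$.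
   Context: Notation: $\mathbb{N}=\{0,1,2,\dots\}$, $\mathbb{C}^{\times}=\mathbb{C}\setminus\{0\}$, $\overline{U}$ is the closure of $U$ in $\mathbb{C}$. The lattice slope $\mathfrak{c}$ is distinct from the coefficient $c$ of $\phi$. $\mathcal{P}=\mathbb{C}[x]$ is the space of complex polynomials, with the strict inductive limit topology of the finite-dimensional spaces $\mathcal{P}_n$ of polynomials of degree at most $n$; $\mathcal{P}'$ is its continuous dual (every linear functional on $\mathcal{P}$ is continuous), with pairing $\langle\cdot,\cdot\rangle$. The weak topology $\sigma(\mathcal{P}',\mathcal{P})$ is that of pointwise convergence on $\mathcal{P}$. For $p\in\mathcal{P}$, $\mathbf{u}\in\mathcal{P}'$, $p\mathbf{u}\in\mathcal{P}'$ is defined by $\langle p\mathbf{u},q\rangle=\langle\mathbf{u},pq\rangle$ for $q\in\mathcal{P}$. For a linear lattice $X(s)=\mathfrak{c}s+\mathfrak{d}$, $\mathfrak{c}\neq 0$, define on $\mathcal{P}$ $$(\mathrm{D}_Xp)(x)=\frac{p(x+\mathfrak{c}/2)-p(x-\mathfrak{c}/2)}{\mathfrak{c}},\qquad(\mathrm{S}_Xp)(x)=\frac{p(x+\mathfrak{c}/2)+p(x-\mathfrak{c}/2)}{2},$$ and on $\mathcal{P}'$, $\langle\boldsymbol{\mathrm{D}}_X\mathbf{u},p\rangle=-\langle\mathbf{u},\mathrm{D}_Xp\rangle$ and $\langle\boldsymbol{\mathrm{S}}_X\mathbf{u},p\rangle=\langle\mathbf{u},\mathrm{S}_Xp\rangle$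 for $p\in\mathcal{P}$. *)

(* Defs.v *)
From HB Require Import structures.
From mathcomp Require Import all_boot all_order all_algebra.
From mathcomp Require Import boolp classical_sets functions filter reals.
From mathcomp Require Import topology normedtype.
From mathcomp Require Import complex.

Set Implicit Arguments.
Unset Strict Implicit.
Unset Printing Implicit Defensive.

Import Order.TTheory GRing.Theory Num.Theory.
Import numFieldNormedType.Exports.

Local Open Scope classical_set_scope.
Local Open Scope ring_scope.
Local Open Scope complex_scope.

(* R[i] is not given a topology by the libraries; this is the usual one, the  *)
(* metric topology of the modulus that every numFieldType carries.            *)
HB.instance Definition _ (R : realType) := NormedModule.copy R[i] R[i]^o.

(* P': for the strict inductive limit topology of the spaces of polynomials   *)
(* of bounded degree every linear functional is continuous, so the continuous *)
(* dual is the space of all linear functionals.                               *)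
Notation pdual R := {scalar {poly R[i]}}.

Record linear_lattice (R : realType) := LinearLattice {
  slope : R[i];
  offset : R[i] }.

Definition lattice_fun (R : realType) (X : linear_lattice R) (s : R[i]) : R[i] :=
  slope X * s + offset X.

Coercion lattice_fun : linear_lattice >-> Funclass.

Section Operators.
Variable R : realType.
Implicit Types (X : linear_lattice R) (u v : pdual R) (p q : {poly R[i]}).

(* p(x + h) as a polynomial in x *)
Definition shiftp (h : R[i]) p : {poly R[i]} := p \Po ('X + h%:P).

Definition DX X p : {poly R[i]} :=
  (slope X)^-1 *: (shiftp (slope X / 2) p - shiftp (- (slope X / 2)) p).

Definition SX X p : {poly R[i]} :=
  2^-1 *: (shiftp (slope X / 2) p + shiftp (- (slope X / 2)) p).

Fact shiftp_is_linear h : linear (shiftp h).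
Proof. by move=> k p q; rewrite /shiftp comp_polyD comp_polyZ. Qed.

HB.instance Definition _ h :=
  GRing.isLinear.Build R[i] {poly R[i]} {poly R[i]} _ (shiftp h)
    (shiftp_is_linear h).

Fact DX_is_linear X : linear (DX X).
Proof.
move=> k p q; rewrite /DX !shiftp_is_linear opprD addrACA -scalerBr.
by rewrite [LHS]scalerDr !scalerA (mulrC k).
Qed.

HB.instance Definition _ X :=
  GRing.isLinear.Build R[i] {poly R[i]} {poly R[i]} _ (DX X) (DX_is_linear X).

Fact SX_is_linear X : linear (SX X).
Proof.
move=> k p q; rewrite /SX !shiftp_is_linear addrACA -scalerDr.
by rewrite [LHS]scalerDr !scalerA (mulrC k).
Qed.

HB.instance Definition _ X :=
  GRing.isLinear.Build R[i] {poly R[i]} {poly R[i]} _ (SX X) (SX_is_linear X).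

Definition mulp p q : {poly R[i]} := p * q.

Fact mulp_is_linear p : linear (mulp p).
Proof. by move=> k q r; rewrite /mulp mulrDr scalerAr. Qed.

HB.instance Definition _ p :=
  GRing.isLinear.Build R[i] {poly R[i]} {poly R[i]} _ (mulp p)
    (mulp_is_linear p).

Definition pmul p u : pdual R := u \o mulp p.

Definition DXdual X u : pdual R := \- (u \o DX X).

Definition SXdual X u : pdual R := u \o SX X.

Definition Ddual u : pdual R := \- (u \o @deriv R[i]).

Lemma pmulE p u q : pmul p u q = u (p * q).
Proof. by []. Qed.

Lemma DXdualE X u p : DXdual X u p = - u (DX X p).
Proof. by []. Qed.

Lemma SXdualE X u p : SXdual X u p = u (SX X p).
Proof. by []. Qed.

Lemma DdualE u p : Ddual u p = - u p^`().
Proof. by []. Qed.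

Lemma horner_DX X p x :
  (DX X p).[x] = (p.[x + slope X / 2] - p.[x - slope X / 2]) / slope X.
Proof.
by rewrite /DX /shiftp hornerZ hornerD hornerN !horner_comp !hornerE mulrC.
Qed.

Lemma horner_SX X p x :
  (SX X p).[x] = (p.[x + slope X / 2] + p.[x - slope X / 2]) / 2.
Proof. by rewrite /SX /shiftp hornerZ hornerD !horner_comp !hornerE mulrC. Qed.

(* the divided difference of p along the lattice X *)
Lemma DX_lattice X p s :
  (DX X p).[X s] =
  (p.[X (s + 2^-1)] - p.[X (s - 2^-1)]) / (X (s + 2^-1) - X (s - 2^-1)).
Proof.
rewrite horner_DX /lattice_fun !mulrDr mulrN; set t := slope X / 2.
rewrite [slope X * s + t + _]addrAC [slope X * s - t + _]addrAC.
by rewrite opprD addrACA subrr add0r opprK -splitr.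
Qed.

Lemma pdual_ext u v : u =1 v -> u = v.
Proof.
case: u v => [u [[u1] [u2]]] [v [[v1] [v2]]] /= /funext uv.
by subst v; congr (GRing.Linear.Pack (GRing.Linear.Class _ _));
  [congr Algebra.isNmodMorphism.Axioms_ | congr GRing.isScalable.Axioms_];
  exact: Prop_irrelevance.
Qed.

End Operators.

(* Convergence of u_z as z tends to 0 within U, for the weak topology         *)
(* sigma(P', P), i.e. the topology of pointwise convergence on P.             *)
Definition weak_cvg_at0 (R : realType) (U : set R[i]) (u : R[i] -> pdual R)
    (u0 : pdual R) : Prop :=
  {ptws, (fun z => u z : {poly R[i]} -> R[i]) @ within U (nbhs (0 : R[i]))
     --> (u0 : {poly R[i]} -> R[i])}.

Lemma weak_cvg_at0P (R : realType) (U : set R[i]) (u : R[i] -> pdual R)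
    (u0 : pdual R) :
  weak_cvg_at0 U u u0 <->
  forall p, u z p @[z --> within U (nbhs (0 : R[i]))] --> u0 p.
Proof.
have surj p : (fun f : {poly R[i]} -> R[i] => f p) @` setT = setT.
  by apply/seteqP; split => // z _; exists (cst z).
rewrite /weak_cvg_at0 cvg_sup; split => cvu p.
  have FF : Filter ((fun z => u z : {poly R[i]} -> R[i]) @
    within U (nbhs (0 : R[i]))) by exact: fmap_filter.
  have {}cvu := (cvg_image _ FF (surj p)).1 (cvu p).
  move=> A /cvu[B FB <-]; rewrite nbhs_filterE /fmap /=.
  rewrite /= nbhs_filterE in FB.
  by apply: (filterS _ FB) => z Bz; exists (u z).
apply/cvg_image; first exact: surj.
move=> A /cvu FA; exists ((fun f => f p) @^-1` A) => //.
by rewrite image_preimage.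
Qed.

(* Main.v *)
Require Import Defs.
From HB Require Import structures.
From mathcomp Require Import all_boot all_order all_algebra.
From mathcomp Require Import ring.
From mathcomp Require Import boolp classical_sets functions filter reals.
From mathcomp Require Import topology normedtype.
From mathcomp Require Import complex.

Set Implicit Arguments.
Unset Strict Implicit.
Unset Printing Implicit Defensive.

Import Order.TTheory GRing.Theory Num.Theory.
Import numFieldNormedType.Exports.

Local Open Scope classical_set_scope.
Local Open Scope ring_scope.
Local Open Scope complex_scope.

(** Write z for the slope. Expanding p(x + z/2) and p(x - z/2) by Taylor's
    formula, D_X p = p' + (terms carrying a positive power of z) and
    S_X p = p + (terms carrying a positive power of z), where every extra term
    is a number tending to 0 with z times one of the fixed polynomials p''/2!,
    p'''/3!, and so on. Hence the discrete functional equation, tested on p,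
    reads
      u_z (phi p' + psi p) = - sum of (small in z) * u_z (phi or psi times a
      higher derivative of p),
    which is [pearson_expansion].

    As soon as the pairings on the right converge, the left side tends to 0
    ([pearson_cvg0]). This is used twice.

    Existence of the limit: for p = x^n the left side is
    u_z ((a n + d) x^(n+1) + lower terms), whereas the polynomials on the right
    have degree at most n, because two derivatives compensate the degree of
    phi. Since a n + d != 0, the convergence of u_z x^(n+1) follows from that
    of the lower moments; the induction starts from u_z 1 = 1
    ([pearson_pairing_cvg]). The pointwise limit of linear functionals is
    linear, and it is unique because the slopes accumulate at 0.

    Limit equation: now all pairings converge, so u_0 (phi p' + psi p) = 0 for
    every p, which is D(phi u_0) = psi u_0. *)

(** The range goes two steps past the degree, so that the terms of order 0 and
    1 can always be split off and the rest is indexed by i < size p. *)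
Lemma shiftp_taylor (R : realType) (h : R[i]) (p : {poly R[i]}) :
  shiftp h p = \sum_(i < (size p).+2) h ^+ i *: p^`N(i).
Proof.
rewrite /shiftp /comp_poly (@nderiv_taylor_wide _ (size p).+2) ?size_map_polyC.
- apply: eq_bigr => i _.
  by rewrite nderivn_map -/(p^`N(i) \Po 'X) comp_polyXr -rmorphXn mulrC mul_polyC.
- exact: mulrC.
- by rewrite -addn2 leq_addr.
Qed.

Lemma DX_taylor (R : realType) (X : linear_lattice R) (p : {poly R[i]}) :
  slope X != 0 ->
  DX X p = p^`() + \sum_(i < size p)
    ((slope X / 2) ^+ i.+1 * ((1 - (-1) ^+ i) / 2)) *: p^`N(i.+2).
Proof.
move=> h0; rewrite /DX !shiftp_taylor -sumrB scaler_sumr !big_ord_recl /=.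
rewrite !expr0 subrr scaler0 add0r !expr1 nderivn1; congr (_ + _).
  by rewrite -scalerBl scalerA; rewrite -[RHS]scale1r; congr (_ *: _); by field.
apply: eq_bigr => i _; rewrite /bump /= !add1n -scalerBl scalerA; congr (_ *: _).
rewrite [(- (slope X / 2)) ^+ _]exprNn !exprS.
by field; rewrite h0.
Qed.

Lemma SX_taylor (R : realType) (X : linear_lattice R) (p : {poly R[i]}) :
  SX X p = p + \sum_(i < size p)
    ((slope X / 2) ^+ i.+2 * ((1 + (-1) ^+ i) / 2)) *: p^`N(i.+2).
Proof.
rewrite /SX !shiftp_taylor -big_split /= scaler_sumr !big_ord_recl /=.
rewrite !expr0 !expr1 nderivn1 nderivn0 scale1r scaleNr subrr scaler0 add0r.
congr (_ + _).
  rewrite scalerDr -scalerDl -[RHS]scale1r; congr (_ *: _); by field.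
apply: eq_bigr => i _; rewrite /bump /= !add1n -scalerDl scalerA; congr (_ *: _).
rewrite [(- (slope X / 2)) ^+ _]exprNn !exprS.
by field.
Qed.

(** The equation D_X(phi v) = S_X(psi v) as a perturbation of
    D(phi v) = psi v: the slope enters the right-hand side only through scalar
    factors that vanish with it. *)
Lemma pearson_expansion (R : realType) (X : linear_lattice R)
    (phi psi : {poly R[i]}) (v : pdual R) (p : {poly R[i]}) :
  slope X != 0 -> DXdual X (pmul phi v) = SXdual X (pmul psi v) ->
  v (phi * p^`() + psi * p) =
  - \sum_(i < size p)
      ((slope X / 2) ^+ i.+1 * ((1 - (-1) ^+ i) / 2) * v (phi * p^`N(i.+2)) +
       (slope X / 2) ^+ i.+2 * ((1 + (-1) ^+ i) / 2) * v (psi * p^`N(i.+2))).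
Proof.
move=> h0 /(congr1 (fun w : pdual R => w p)).
rewrite DXdualE SXdualE !pmulE DX_taylor // SX_taylor !mulrDr !(linearD v) /=.
rewrite !mulr_sumr !(linear_sum v) big_split /=.
under eq_bigr do rewrite -scalerAr linearZ /=.
under [X in _ = _ + X -> _]eq_bigr do rewrite -scalerAr linearZ /=.
by move=> E; apply/eqP; rewrite -subr_eq0 opprK addrACA -E subrr.
Qed.

(** Two derivatives make up for multiplication by a quadratic polynomial, so
    the perturbation terms never involve moments beyond the degree of p. *)
Lemma size_mul_nderivn (R : nzRingType) (q p : {poly R}) (i : nat) :
  (size q <= 3)%N -> (size (q * p^`N(i.+2))%R <= size p)%N.
Proof.
move=> sq; have [sp|sp] := leqP (size p) i.+2.
  by rewrite nderivn_poly0 // mulr0 size_poly0.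
have sd : (size p^`N(i.+2) <= size p - 2)%N.
  apply/leq_sizeP => j; rewrite leq_subLR => pj; rewrite coef_nderivn.
  by rewrite nth_default ?mul0rn // (leq_trans pj) // leq_add2r.
apply: leq_trans (size_polyMleq _ _) _; rewrite -subn1 leq_subLR.
apply: leq_trans (leq_add sq sd) _.
by rewrite addnBA ?(leq_trans _ sp) // leq_subLR addnA.
Qed.

(** The leading coefficient a m + d is what makes the moment recurrence
    solvable for the moment of order m + 1. *)
Lemma pearson_Xn (R : comNzRingType) (a b c d e : R) (m : nat) :
  let phi : {poly R} := a *: 'X^2 + b *: 'X + c%:P in
  let psi : {poly R} := d *: 'X + e%:P in
  exists2 r : {poly R}, (size r <= m.+1)%N &
    phi * ('X^m)^`() + psi * 'X^m = (a * m%:R + d) *: 'X^(m.+1) + r.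
Proof.
move=> phi psi.
exists ((b * m%:R + e) *: 'X^m + (c * m%:R) *: 'X^(m.-1)).
  apply/leq_sizeP => j mj; rewrite coefD !coefZ !coefXn !gtn_eqF // ?mulr0 ?addr0 //.
  exact: leq_ltn_trans (leq_pred m) mj.
rewrite derivXn /phi /psi -!mul_polyC !polyCD !polyCM polyC_natr.
case: m => [|m] /=; first by rewrite expr0 expr1; ring.
by rewrite !exprS; ring.
Qed.

Lemma cvg0M (R : realType) (F : set_system R[i]) {FF : Filter F}
    (f g : R[i] -> R[i]) (l : R[i]) :
  f z @[z --> F] --> (0 : R[i]) -> g z @[z --> F] --> l ->
  f z * g z @[z --> F] --> (0 : R[i]).
Proof.
move=> f0 gl; have fg := cvgM f0 gl.
rewrite mul0r in fg; exact: fg.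
Qed.

Lemma cvg_half_expM0 (R : realType) (U : set R[i]) (n : nat) (k : R[i])
    (f : R[i] -> R[i]) :
  cvg (f z @[z --> within U (nbhs (0 : R[i]))]) ->
  (z / 2) ^+ n.+1 * k * f z @[z --> within U (nbhs (0 : R[i]))] --> (0 : R[i]).
Proof.
move=> /cvg_ex[l fl].
have z0 : z @[z --> within U (nbhs (0 : R[i]))] --> (0 : R[i]).
  exact: (@cvg_within _ (nbhs (0 : R[i]))).
have z20 : z / 2 @[z --> within U (nbhs (0 : R[i]))] --> (0 : R[i]).
  exact: (cvg0M z0 (cvg_cst (2^-1 : R[i]))).
have zn0 m : (z / 2) ^+ m.+1 @[z --> within U (nbhs (0 : R[i]))] --> (0 : R[i]).
  elim: m => [|m IHm]; first exact: z20.
  exact: (cvg0M z20 IHm).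
exact: (cvg0M (cvg0M (zn0 n) (cvg_cst k)) fl).
Qed.

(** The continuous functional equation holds in the limit on any p for which
    the pairings in the perturbation terms converge; asking only for those
    allows its use inside the induction on the degree. *)
Lemma pearson_cvg0 (R : realType) (U : set R[i]) (dd : R[i])
    (u : R[i] -> pdual R) (phi psi p : {poly R[i]}) :
  U `<=` [set z | z != 0] ->
  (forall z, U z -> let X := LinearLattice z dd in
     DXdual X (pmul phi (u z)) = SXdual X (pmul psi (u z))) ->
  (forall i, cvg (u z (phi * p^`N(i.+2)) @[z --> within U (nbhs (0 : R[i]))])) ->
  (forall i, cvg (u z (psi * p^`N(i.+2)) @[z --> within U (nbhs (0 : R[i]))])) ->
  u z (phi * p^`() + psi * p) @[z --> within U (nbhs (0 : R[i]))] --> (0 : R[i]).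
Proof.
move=> U0 eqX cphi cpsi.
have FF : Filter (within U (nbhs (0 : R[i]))) by exact: within_filter.
pose term i z :=
  (z / 2) ^+ i.+1 * ((1 - (-1) ^+ i) / 2) * u z (phi * p^`N(i.+2)) +
  (z / 2) ^+ i.+2 * ((1 + (-1) ^+ i) / 2) * u z (psi * p^`N(i.+2)).
have term0 i : term i z @[z --> within U (nbhs (0 : R[i]))] --> (0 + 0 : R[i]).
  exact: (cvgD (cvg_half_expM0 _ _ (cphi i)) (cvg_half_expM0 _ _ (cpsi i))).
have rem0 : - \sum_(i < size p) term i z @[z --> within U (nbhs (0 : R[i]))]
    --> - \sum_(i < size p) (0 + 0 : R[i]).
  by apply: cvgN; apply: cvg_big => [|i _]; [exact: add_continuous|exact: term0].
rewrite addr0 big1_eq oppr0 in rem0.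
apply: cvg_trans rem0; apply: near_eq_cvg.
apply: filterS (@withinT _ (nbhs (0 : R[i])) U _) => z Uz /=.
exact: esym (@pearson_expansion _ (LinearLattice z dd) _ _ _ p (U0 _ Uz)
  (eqX _ Uz)).
Qed.

(** Induction on the degree: modulo lower degree, x^(n+1) is a multiple of
    phi (x^n)' + psi x^n, whose pairing with u_z tends to 0. *)
Lemma pearson_pairing_cvg (R : realType) (U : set R[i]) (dd : R[i])
    (u : R[i] -> pdual R) (a b c d e : R[i]) :
  let phi : {poly R[i]} := a *: 'X^2 + b *: 'X + c%:P in
  let psi : {poly R[i]} := d *: 'X + e%:P in
  U `<=` [set z | z != 0] ->
  (forall n : nat, a * n%:R + d != 0) ->
  (forall z, U z -> let X := LinearLattice z dd in
     DXdual X (pmul phi (u z)) = SXdual X (pmul psi (u z))) ->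
  (forall z, U z -> u z 1 = 1) ->
  forall p, cvg (u z p @[z --> within U (nbhs (0 : R[i]))]).
Proof.
move=> phi psi U0 ad0 eqX u1 p.
have sphi : (size phi <= 3)%N.
  apply/leq_sizeP => -[|[|[|j]]] // _.
  by rewrite /phi !coefD !coefZ coefXn coefX coefC /= !mulr0 !addr0.
have spsi : (size psi <= 3)%N.
  apply/leq_sizeP => -[|[|[|j]]] // _.
  by rewrite /psi coefD coefZ coefX coefC /= mulr0 addr0.
have cvg_lin k q r : cvg (u z q @[z --> within U (nbhs (0 : R[i]))]) ->
    cvg (u z r @[z --> within U (nbhs (0 : R[i]))]) ->
    cvg (u z (k *: q + r) @[z --> within U (nbhs (0 : R[i]))]).
  move=> /cvg_ex[l ql] /cvg_ex[m rm]; apply/cvg_ex; exists (k * l + m).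
  under eq_cvg do rewrite linearP.
  exact: (cvgD (cvgM (cvg_cst k) ql) rm).
have [n] := ubnPleq (size p); elim: n p => [|n IHn] p.
  rewrite leqn0 size_poly_eq0 => /eqP ->; apply: (cvgP (0 : R[i])).
  by under eq_cvg do rewrite linear0; exact: cvg_cst.
suff cXn : cvg (u z 'X^n @[z --> within U (nbhs (0 : R[i]))]).
  move=> sp; have -> : p = p`_n *: 'X^n + (p - p`_n *: 'X^n).
    by rewrite addrC subrK.
  apply: (cvg_lin _ _ _ cXn); apply: IHn; apply/leq_sizeP => j; rewrite leq_eqVlt => /predU1P[<-|nj].
    by rewrite coefB coefZ coefXn eqxx mulr1 subrr.
  rewrite coefB coefZ coefXn gtn_eqF // mulr0 subr0.
  by move/leq_sizeP: sp; apply.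
case: n IHn => [|n] IHn.
  apply: (cvgP (1 : R[i])); apply: cvg_near_cst.
  by apply: filterS (@withinT _ (nbhs (0 : R[i])) U _) => z /u1.
have [r sr Er] := pearson_Xn a b c d e n.
have -> : 'X^(n.+1) =
    (a * n%:R + d)^-1 *: (phi * ('X^n)^`() + psi * 'X^n) +
    - (a * n%:R + d)^-1 *: r.
  by rewrite /phi /psi Er scalerDr scaleNr addrK scalerA mulVf // scale1r.
apply: cvg_lin; last by apply: IHn; exact: leq_trans (size_scale_leq _ _) sr.
apply: cvgP; apply: pearson_cvg0 U0 eqX _ _ => i; apply: IHn.
  by apply: leq_trans (size_mul_nderivn _ _ sphi) _; rewrite size_polyXn.
by apply: leq_trans (size_mul_nderivn _ _ spsi) _; rewrite size_polyXn.
Qed.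

Lemma ptws_cvg_scalar (R : realType) (F : set_system R[i]) (FF : ProperFilter F)
    (u : R[i] -> pdual R) :
  (forall p, cvg (u z p @[z --> F])) ->
  exists u0 : pdual R, forall p, u z p @[z --> F] --> u0 p.
Proof.
move=> cu; pose l p : R[i] := lim (u z p @[z --> F]).
have l_linear : linear_for *%R l.
  move=> k p q; apply: cvg_lim; first exact: norm_hausdorff.
  under eq_cvg do rewrite linearP.
  by apply: cvgD; [apply: cvgM; [exact: cvg_cst|exact: cu]|exact: cu].
pose lL := GRing.isLinear.Build R[i] {poly R[i]} R[i] _ l l_linear.
pose u0 : pdual R := HB.pack l lL.
by exists u0 => p; exact: cu.
Qed.

Theorem proposition6p2 (R : realType) (U : set R[i]) (dd : R[i])
    (u : R[i] -> pdual R) (a b c d e : R[i]) :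
  let phi : {poly R[i]} := a *: 'X^2 + b *: 'X + c%:P in
  let psi : {poly R[i]} := d *: 'X + e%:P in
  U `<=` [set z | z != 0] ->
  closure U 0 ->
  (forall n : nat, a * n%:R + d != 0) ->
  (forall cc, U cc -> (u cc : {poly R[i]} -> R[i]) <> \0) ->
  (forall cc, U cc ->
     let X := LinearLattice cc dd in
     DXdual X (pmul phi (u cc)) = SXdual X (pmul psi (u cc))) ->
  (forall cc, U cc -> u cc 1 = 1) ->
  (exists! u0 : pdual R, weak_cvg_at0 U u u0) /\
  (forall u0 : pdual R, weak_cvg_at0 U u u0 ->
     Ddual (pmul phi u0) = pmul psi u0).
Proof.
move=> phi psi U0 clU ad0 _ eqX u1.
have FF : ProperFilter (within U (nbhs (0 : R[i]))) by exact: within_nbhs_proper.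
have cu : forall p, cvg (u z p @[z --> within U (nbhs (0 : R[i]))]).
  exact: pearson_pairing_cvg U0 ad0 eqX u1.
have cvg_uniq (f : R[i] -> R[i]) (l l' : R[i]) :
    f z @[z --> within U (nbhs (0 : R[i]))] --> l ->
    f z @[z --> within U (nbhs (0 : R[i]))] --> l' -> l = l'.
  exact: (cvg_unique (@norm_hausdorff _ R[i])).
split=> [|u0 /weak_cvg_at0P cvu0].
  have [u0 cvu0] := ptws_cvg_scalar FF cu.
  exists u0; split=> [|v /weak_cvg_at0P cvv]; first exact/weak_cvg_at0P.
  by apply: pdual_ext => p; exact: cvg_uniq (cvu0 p) (cvv p).
apply: pdual_ext => p; rewrite DdualE !pmulE.
apply/eqP; rewrite eq_sym -addr_eq0 addrC -linearD; apply/eqP.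
apply: cvg_uniq (cvu0 _) _.
exact: (pearson_cvg0 U0 eqX (fun i => cu (phi * p^`N(i.+2)))
                            (fun i => cu (psi * p^`N(i.+2)))).
Qed.
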